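(* Let $K$ be a number field with ring of integers $\mathcal{O}_K$. Every non-trivial integral ideal $\mathfrak{A}$ (i.e. $0\neq\mathfrak{A}\subsetneq\mathcal{O}_K$) is strictly large in $\overline{\mathbb{Q}}$; that is, there is a number field $K'$ with $K\subseteq K'\subseteq\overline{\mathbb{Q}}$ such that the ideal $\mathfrak{A}\mathcal{O}_{K'}$ is strictly large in $\mathcal{O}_{K'}$.
   Context: For a number field $K'$, an element $x\in\mathcal{O}_{K'}$ is strictly large if $|\sigma(x)|>1$ for every embedding $\sigma:K'\to\mathbb{C}$; an ideal of $\mathcal{O}_{K'}$ is strictly large if it is principal and has a strictly large generator. *)

(* Defs.v *)
From HB Require Import structures.
From mathcomp Require Import all_boot all_order all_algebra all_field.
From mathcomp Require Import ring_quotient complex.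
From mathcomp Require Import boolp classical_sets reals.

Set Implicit Arguments.
Unset Strict Implicit.
Unset Printing Implicit Defensive.

Import Order.TTheory GRing.Theory Num.Theory.
Local Open Scope ring_scope.
Local Open Scope classical_set_scope.

(* A number field is a fieldExtType rat: a field of finite dimension over Q.
   Since integralOver is a Prop, asbool turns it into a boolean predicate. *)
Definition integral_elt (K : fieldExtType rat) : {pred K} :=
  fun x => `[< integralOver (intr : int -> K) x >].
Arguments integral_elt : clear implicits.

Lemma integral_eltP (K : fieldExtType rat) (x : K) :
  reflect (integralOver (intr : int -> K) x) (x \in integral_elt K).
Proof. exact: asboolP. Qed.

Lemma integral_elt_subring (K : fieldExtType rat) :
  subring_closed (integral_elt K).
Proof.
split=> [|x y /integral_eltP Zx /integral_eltP Zy
         |x y /integral_eltP Zx /integral_eltP Zy]; apply/integral_eltP.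
- exact: integral1.
- exact: integral_sub.
- exact: integral_mul.
Qed.

HB.instance Definition _ (K : fieldExtType rat) :=
  GRing.isSubringClosed.Build K (integral_elt K) (@integral_elt_subring K).

Record integers (K : fieldExtType rat) : Type := Integers {
  int_val :> K;
  int_valP : int_val \in integral_elt K
}.

HB.instance Definition _ (K : fieldExtType rat) :=
  [isSub for @int_val K].
HB.instance Definition _ (K : fieldExtType rat) :=
  [Choice of integers K by <:].
HB.instance Definition _ (K : fieldExtType rat) :=
  [SubChoice_isSubComNzRing of integers K by <:].

Lemma integral_elt_rmorph (K L : fieldExtType rat) (f : {rmorphism K -> L})
  (x : integers K) : f (int_val x) \in integral_elt L.
Proof.
have /integral_eltP/(@integral_rmorph _ _ _ _ f) Zfx := int_valP x.
apply/integral_eltP; case: Zfx => p mon_p pfx0; exists p => //.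
by rewrite -(@eq_map_poly _ _ (f \o intr)) // => n /=; rewrite rmorph_int.
Qed.

Definition int_map (K L : fieldExtType rat) (f : {rmorphism K -> L})
  (x : integers K) : integers L := Integers (integral_elt_rmorph f x).

Definition ideal_span (O : comNzRingType) (S : set O) : set O :=
  [set y | exists (n : nat) (b s : 'I_n -> O),
     (forall i, S (s i)) /\ y = \sum_(i < n) b i * s i].

Definition ideal_ext (K L : fieldExtType rat) (f : {rmorphism K -> L})
  (A : {pred integers K}) : set (integers L) :=
  ideal_span (int_map f @` [set` A]).

(* R : realType is a model of the real numbers, so R[i] is one of the complex
   numbers. The order on R[i] compares elements with the same imaginary part,
   and the norm of R[i] takes nonnegative real values in R[i]. *)
Definition strictly_large (R : realType) (K : fieldExtType rat)
  (x : integers K) : Prop :=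
  forall sigma : {rmorphism K -> R[i]}, 1 < `|sigma (int_val x)|.

Definition principal_ideal (O : comNzRingType) (g : O) : set O :=
  [set g * y | y in [set: O]].

Definition strictly_large_ideal (R : realType) (K : fieldExtType rat)
  (I : set (integers K)) : Prop :=
  exists g : integers K, I = principal_ideal g /\ strictly_large R g.

(* Main.v *)
Require Import Defs.
From HB Require Import structures.
From mathcomp Require Import all_boot all_order all_algebra all_field.
From mathcomp Require Import ring_quotient complex.
From mathcomp Require Import boolp classical_sets reals.
From mathcomp Require Import perm ring lra zify.

(* Let [P_k] be the [k]-th power of the ideal [A] and [x_k] a nonzero element of
   [P_k] of minimal height (the sum of the absolute values of the coordinates in an
   integral basis). By Dirichlet's approximation argument [m P_k] lies in [x_k O]
   for a constant [m], so [x_k^-1 P_k] takes finitely many values. By a pigeonhole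
   argument modulo [x_k O], whose index is the norm of [x_k], minimality forces
   [|N(x_k)| >= c height(x_k)^d], so all conjugates of [x_k] have size comparable
   to [height(x_k)]. Those heights are unbounded, since otherwise [P_k = P_l] for
   some [k < l] and Nakayama's lemma puts [1] in [A]. Hence there are [k < l] with
   [x_k^-1 P_k = x_l^-1 P_l] such that [x := x_l / x_k] has all its conjugates
   outside the unit disc. Finally [beta := x^(1/(l-k))] generates the extension of
   [A] to a number field containing it: [A / beta] is an integral ideal [B] with
   [B J = J], [J] being the extension of [P_k], so [1] is in [B] by Nakayama. *)

Set Implicit Arguments.
Unset Strict Implicit.
Unset Printing Implicit Defensive.

Import Order.TTheory GRing.Theory Num.Theory.
Import passmx.
Local Open Scope ring_scope.

(** * Pigeonhole principles, integer lattices and Nakayama's lemma *)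

Lemma pigeonhole (T T' : finType) (f : T -> T') :
  (#|T'| < #|T|)%N -> exists x y, x != y /\ f x = f y.
Proof.
move=> ltT; have /injectivePn[x [y xy fxy]] : ~~ injectiveb f.
  by apply: contraL ltT => /injectiveP/leq_card; rewrite -leqNgt.
by exists x, y.
Qed.

(** Some value is taken at arbitrarily large indices. Fix one such index [k]; the value occurs again
    beyond both [k] and the threshold for [R k]. *)
Lemma nat_pigeonhole (T : finType) (f : nat -> T) (R : nat -> nat -> Prop) :
    (forall k, exists l0, forall l, (l0 <= l)%N -> R k l) ->
  exists k l, [/\ (k < l)%N, f k = f l & R k l].
Proof.
move=> evR; have [t inf_t] : exists t, forall N, exists2 k, (N <= k)%N & f k = t.
  apply: contrapT => /forallNP noT.
  have /choice[g gP] t : exists N, forall k, (N <= k)%N -> f k <> t.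
    have /existsNP[N /forall2NP gt_N] := noT t.
    by exists N => k Nk; case: (gt_N k).
  by apply: (gP (f (\max_t g t)) (\max_t g t)); rewrite ?(leq_bigmax (f _)).
have [k _ fk] := inf_t 0%N; have [l0 l0P] := evR k.
have [l ll fl] := inf_t (maxn k.+1 l0).
by move: ll; rewrite geq_max => /andP[kl /l0P Rkl]; exists k, l; split; rewrite ?fk.
Qed.

(** With the Smith normal form $M = L D R$, the entries of [v x *m invmx R] modulo the diagonal of
    $D$ determine [v x] modulo the row lattice of [M]. This leaves at most $|\det M|$ classes. *)
Lemma congruent_mod_lattice n (M : 'M[int]_n) (T : finType) (v : T -> 'rV[int]_n) :
    \det M != 0 -> (`|\det M| < #|T|)%N ->
  exists x y w, x != y /\ v x - v y = w *m M.
Proof.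
have [L uL [R uR [d _ ->]]] := int_Smith_normal_form M.
set D := \matrix_(i, j) _.
have DE : D = diag_mx (\row_i d`_i).
  by apply/matrixP=> i j; rewrite !mxE.
have abs_unit (A : 'M[int]_n) : A \in unitmx -> `|\det A|%N = 1%N.
  move=> uA; have /(congr1 absz)/eqP := congr1 determinant (mulmxV uA).
  by rewrite det_mulmx det1 abszM muln_eq1 => /andP[/eqP].
rewrite !det_mulmx !abszM (abs_unit L) // (abs_unit R) // !mulf_eq0 !negb_or muln1 mul1n.
move=> /andP[/andP[_ D0] _]; move: D0; rewrite DE det_diag.
under eq_bigr do rewrite mxE; move=> /prodf_neq0 d0.
have {}d0 (i : 'I_n) : d`_i != 0 by apply: d0.
have mod_lt (i : 'I_n) (z : int) : (`|(z %% d`_i)%Z| < absz (d`_i)%R)%N.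
  by rewrite -ltz_nat gez0_abs ?modz_ge0 ?d0 ?ltz_mod ?d0.
move=> cardT.
pose r (x : T) : {dffun forall i : 'I_n, 'I_(absz (d`_i)%R)} :=
  [ffun i => Ordinal (mod_lt i ((v x *m invmx R) 0 i))].
have [|x [y [xy rxy]]] := @pigeonhole _ _ r.
  rewrite card_dep_ffun foldrE big_image /=.
  rewrite (eq_bigr (fun i : 'I_n => absz (d`_i)%R)) => [|i _]; last exact: card_ord.
  by rewrite -(big_morph _ abszM absz1).
exists x, y.
pose u := \row_i divz (((v x - v y) *m invmx R) 0 i) d`_i.
exists (u *m invmx L); split=> //.
rewrite !mulmxA mulmxKV // -[LHS](mulmxKV uR); congr (_ *m _).
apply/rowP=> i; rewrite mul_mx_diag [RHS]mxE [X in X * _]mxE [X in _ * X]mxE divzK //.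
have /ffunP/(_ i) := rxy; rewrite !ffunE => /(congr1 val) /= /(congr1 Posz).
rewrite !gez0_abs ?modz_ge0 ?d0 // => /eqP; rewrite eqz_mod_dvd.
by rewrite mulmxBl [X in _ -> (_ %| X)%Z]mxE [X in _ -> (_ %| _ + X)%Z]mxE.
Qed.

(** [B] is a subring without unit, so it absorbs integer multiples, and congruence to an integer
    modulo [B] passes to sums and products. The Leibniz formula then compares the determinant with
    that of the integer identity matrix. *)
Lemma det_sub_in_subrng (F : comNzRingType) (B : F -> Prop) n (b : 'M[F]_n) :
    B 0 -> (forall x y, B x -> B y -> B (x - y)) ->
    (forall x y, B x -> B y -> B (x * y)) -> (forall i j, B (b i j)) ->
  B (\det (1%:M - b) - 1).
Proof.
move=> B0 Bsub Bmul Bb.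
have Bopp x : B x -> B (- x) by move=> Bx; rewrite -sub0r; apply: (Bsub).
have Badd x y : B x -> B y -> B (x + y).
  by move=> Bx By; rewrite -[y]opprK; apply: (Bsub) => //; apply: (Bopp).
have Bnat x k : B x -> B (x *+ k).
  by move=> Bx; elim: k => [|k IHk]; rewrite ?mulr0n // mulrS; apply: (Badd).
have Bint x (m : int) : B x -> B (x *~ m).
  by case: m => m Bx; [|rewrite NegzE mulrNz; apply: (Bopp)]; apply: Bnat.
pose r (x : F) (m : int) := B (x - m%:~R).
have rM x m y k : r x m -> r y k -> r (x * y) (m * k).
  rewrite /r => rx ry.
  have -> : x * y - (m * k)%:~R = (x - m%:~R) * (y - k%:~R)
      + (y - k%:~R) *~ m + (x - m%:~R) *~ k.
    rewrite -[(y - _) *~ m]mulrzl -[(x - _) *~ k]mulrzr intrM.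
    by move: (m%:~R) (k%:~R) => a c; ring.
  by apply: (Badd); [apply: (Badd); [apply: Bmul | apply: (Bint)] | apply: Bint].
have rD x m y k : r x m -> r y k -> r (x + y) (m + k).
  by rewrite /r intrD opprD addrACA; apply: (Badd).
suff : r (\det (1%:M - b)) (\det (1%:M : 'M[int]_n)) by rewrite /r det1 mulr1z.
apply: (big_rec2 r) => [|s m x _ rx]; first by rewrite /r mulr0z subr0.
apply: (rD) => //; apply: (rM); first by rewrite /r rmorph_sign subrr.
apply: (big_rec2 r) => [|i k y _ ry]; first by rewrite /r mulr1z subrr.
apply: (rM) => //; rewrite /r !mxE; case: (i == _); rewrite ?mulr1n ?mulr0n.
  by rewrite mulr1z addrAC subrr sub0r; apply: (Bopp).
by rewrite sub0r mulr0z subr0; apply: (Bopp).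
Qed.

(** The matrix $1 - A$ kills the nonzero vector [g], so its determinant is 0, while it is also
    congruent to 1 modulo [B]. *)
Lemma nakayama (F : fieldType) (B : F -> Prop) n (g : 'I_n -> F) :
    B 0 -> (forall x y, B x -> B y -> B (x - y)) ->
    (forall x y, B x -> B y -> B (x * y)) -> (exists i, g i != 0) ->
    (forall i, exists2 b : 'I_n -> F, forall j, B (b j) & g i = \sum_j b j * g j) ->
  B 1.
Proof.
move=> B0 Bsub Bmul [i0 gi0] bP.
have /choice[b /all_and2[Bb gE]] i :
  exists b : 'I_n -> F, (forall j, B (b j)) /\ g i = \sum_j b j * g j.
  by have [b Bb gE] := bP i; exists b.
pose A := \matrix_(i, j) b i j.
have /eqP detA0 : \det (1%:M - A) == 0.
  rewrite -det_tr; apply/det0P; exists (\row_i g i).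
    by apply: contraNneq gi0 => /rowP/(_ i0); rewrite !mxE => ->.
  apply/trmx_inj; rewrite trmx_mul trmxK trmx0 mulmxBl mul1mx.
  apply/eqP; rewrite subr_eq0; apply/eqP/colP=> i; rewrite !mxE {1}gE.
  by apply: eq_bigr => j _; rewrite !mxE.
have BN1 : B (\det (1%:M - A) - 1).
  by apply: det_sub_in_subrng => // i j; rewrite mxE.
by rewrite detA0 in BN1; have := Bsub _ _ B0 BN1; rewrite !sub0r opprK.
Qed.

Lemma int_subgroup_principal (G : int -> Prop) :
    G 0 -> (forall x y, G x -> G y -> G (x - y)) ->
  exists2 m, G m & forall k, G k -> (m %| k)%Z.
Proof.
move=> G0 Gsub; have Gopp x : G x -> G (- x) by move=> Gx; rewrite -sub0r; apply: Gsub.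
have Gabs x : G x -> G `|x| by case: (ger0P x) => // _ /Gopp.
have Gmuln x k : G x -> G (x * k%:Z).
  move=> Gx; elim: k => [|k IHk]; first by rewrite mulr0.
  by rewrite intS mulrDr mulr1 -[x + _]opprK opprD; apply/Gopp/Gsub => //; apply: Gopp.
have Gmul x y : G x -> G (x * y).
  case: y => k Gx; first exact: Gmuln.
  by rewrite NegzE mulrN; apply/Gopp/Gmuln.
have [exG|noG] := pselect (exists n : nat, `[< (0 < n)%N /\ G n >]); last first.
  exists 0 => // k Gk; rewrite dvd0z -absz_eq0 -leqn0 leqNgt.
  apply/negP => k0; apply: noG; exists `|k|%N; apply/asboolP; split=> //.
  by rewrite abszE; apply: Gabs.
case: (ex_minnP exG) => m /asboolP[m0 Gm] min_m.
exists m => // k Gk; apply/dvdz_mod0P/eqP; rewrite -absz_eq0 -leqn0 leqNgt.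
apply/negP => k0; have /min_m : `[< (0 < `|(k %% m)%Z|)%N /\ G `|(k %% m)%Z|%N >].
  apply/asboolP; split=> //; rewrite abszE; apply: Gabs; rewrite /modz.
  by apply: Gsub => //; rewrite mulrC; apply: Gmul.
by rewrite leqNgt -ltz_nat gez0_abs ?modz_ge0 ?ltz_mod // eqz_nat -lt0n.
Qed.

(** As in echelon form, some [x0] in [G] has a coefficient at [g ord0] dividing all others that
    occur. Subtracting multiples of [x0] leaves elements in the span of the remaining generators, to
    which induction applies. *)
Lemma subgroup_generators (V : zmodType) n (g : 'I_n -> V) (G : V -> Prop) :
    G 0 -> (forall x y, G x -> G y -> G (x - y)) ->
    (forall x, G x -> exists c : 'I_n -> int, x = \sum_i g i *~ c i) ->
  exists h : 'I_n -> V, (forall i, G (h i)) /\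
    forall x, G x -> exists c : 'I_n -> int, x = \sum_i h i *~ c i.
Proof.
elim: n => [|n IHn] in g G * => G0 Gsub Gspan.
  by exists g; split=> // -[].
have Gopp x : G x -> G (- x) by move=> Gx; rewrite -sub0r; apply: (Gsub).
have Gadd x y : G x -> G y -> G (x + y).
  by move=> Gx Gy; rewrite -[y]opprK; apply: (Gsub) => //; apply: (Gopp).
have Gint x (m : int) : G x -> G (x *~ m).
  move=> Gx; have Gnat k : G (x *+ k).
    by elim: k => [|k IHk]; rewrite ?mulr0n // mulrS; apply: (Gadd).
  by case: m => m; [|rewrite NegzE mulrNz; apply: (Gopp)]; apply: Gnat.
pose g' i := g (lift ord0 i).
pose span' x := exists c : 'I_n -> int, x = \sum_i g' i *~ c i.
have span'B x y : span' x -> span' y -> span' (x - y).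
  move=> [c ->] [e ->]; exists (fun i => c i - e i).
  by rewrite -sumrB; apply: eq_bigr => i _; rewrite mulrzBr.
have span'Z x m : span' x -> span' (x *~ m).
  move=> [c ->]; exists (fun i => c i * m).
  by rewrite mulrz_suml; apply: eq_bigr => i _; rewrite mulrzA.
(* The [g i] may be dependent, so an element can have several coefficients at [g ord0]; all are
   collected, and together they form a subgroup of the integers. *)
pose lead m := exists2 x, G x & span' (x - g ord0 *~ m).
have [x0 [m0 [Gx0 lead0 lead_dvd]]] : exists x0 m0, [/\ G x0,
    span' (x0 - g ord0 *~ m0) & forall m, lead m -> (m0 %| m)%Z].
  have [||m0 [x0 Gx0 lead0] dvd_m0] := @int_subgroup_principal lead.
  - exists 0; rewrite // mulr0z subr0; exists (fun=> 0).
    by rewrite big1 // => i _; exact: mulr0z.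
  - move=> m k [x Gx sx] [y Gy sy]; exists (x - y); first exact: Gsub.
    have -> : x - y - g ord0 *~ (m - k) = (x - g ord0 *~ m) - (y - g ord0 *~ k).
      by rewrite mulrzBr !opprB [_ - _ *~ m]addrC addrACA [- y + _]addrC.
    exact: span'B.
  by exists x0, m0.
have [||x [Gx]|h' [Gh' h'span]] := IHn g' (fun x => G x /\ span' x).
- split=> //; exists (fun=> 0); rewrite big1 // => i _; exact: mulr0z.
- by move=> x y [Gx sx] [Gy sy]; split; [apply: (Gsub) | apply: span'B].
- by [].
exists (fun i => if unlift ord0 i is Some j then h' j else x0); split=> [i|x Gx].
  by case: unliftP => // j _; case: (Gh' j).
have [c xE] := Gspan x Gx; rewrite big_ord_recl in xE.
have sx : span' (x - g ord0 *~ c ord0).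
  by exists (fun i => c (lift ord0 i)); rewrite xE addrC addKr.
have /dvdzP[q cE] : (m0 %| c ord0)%Z by apply: lead_dvd; exists x.
have [|e eE] := h'span (x - x0 *~ q).
  split; first by apply: (Gsub) => //; apply: Gint.
  have -> : x - x0 *~ q = (x - g ord0 *~ c ord0) - (x0 - g ord0 *~ m0) *~ q.
    by rewrite cE mulrzBl mulrzA_C mulrzA opprB addrA subrK.
  by apply: span'B => //; apply: span'Z.
exists (fun i => if unlift ord0 i is Some j then e j else q).
rewrite big_ord_recl unlift_none; under eq_bigr do rewrite liftK.
by rewrite -eE addrC subrK.
Qed.

(** * Integral bases *)

(** [y] is an eigenvalue of an integer matrix, hence a root of its characteristic polynomial, which
    is monic. *)
Lemma integral_int_eigen (L : fieldExtType rat) n (v : 'I_n -> L) (P : 'M[int]_n) (y : L) :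
    (exists i, v i != 0) -> (forall i, y * v i = \sum_j (P i j)%:~R * v j) ->
  y \in integral_elt L.
Proof.
move=> [i0 v0] yv; apply/integral_eltP.
exists (char_poly P^T); first exact: char_poly_monic.
rewrite map_char_poly -eigenvalue_root_char; apply/eigenvalueP.
exists (\row_i v i).
  apply/rowP=> i; rewrite !mxE yv; apply: eq_bigr => j _.
  by rewrite !mxE mulrC.
by apply: contraNneq v0 => /rowP/(_ i0); rewrite !mxE => ->.
Qed.

Section Basis.

Variable K : fieldExtType rat.
Local Notation d := (\dim {:K}).
Variable b : d.-tuple K.
Hypothesis b_basis : basis_of fullv b.

Local Notation crd := (rVof b).
Definition mul_mat (x : K) : 'M[rat]_d := mxof b b (amulr x).

Lemma mul_mat_is_linear : linear mul_mat.
Proof. by move=> a x y; rewrite /mul_mat amulr_is_linear mxof_linear. Qed.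
HB.instance Definition _ :=
  GRing.isLinear.Build rat K 'M[rat]_d _ mul_mat mul_mat_is_linear.

Lemma rVofM x y : crd (x * y) = crd x *m mul_mat y.
Proof. by rewrite -rVof_app // lfunE. Qed.

Lemma mul_matM x y : mul_mat (x * y) = mul_mat x *m mul_mat y.
Proof.
apply/row_matrixP => i; rewrite row_mul !rowE.
by rewrite -(rVofE b_basis) -!rVofM mulrA.
Qed.

Lemma mul_mat1 : mul_mat 1 = 1%:M.
Proof.
apply/row_matrixP => i; rewrite !rowE mulmx1.
by rewrite -(rVofE b_basis) -!rVofM mulr1.
Qed.

Lemma rVof_sum x : x = \sum_i crd x 0 i *: b`_i.
Proof.
rewrite {1}(coord_basis b_basis (memvf x)).
by apply: eq_bigr => i _; rewrite coord_rVof.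
Qed.

Lemma mul_mat_sum x (i : 'I_d) : b`_i * x = \sum_j mul_mat x i j *: b`_j.
Proof.
rewrite {1}[_ * x]rVof_sum; apply: eq_bigr => j _.
by rewrite rVofM rVofE // -rowE mxE.
Qed.

(** A polynomial that kills [y] kills its matrix, so the eigenvalues of the matrix are algebraic
    integers. The trace is, up to sign, a coefficient of the characteristic polynomial, hence a
    rational algebraic integer. *)
Lemma trace_integral y : y \in integral_elt K -> \tr (mul_mat y) \is a Num.int.
Proof.
case/integral_eltP=> p mon_p py0; rewrite -Cint_rat -trace_map_mx.
set A := map_mx _ _; apply: Cint_rat_Aint; first by rewrite trace_map_mx Crat_rat.
have horner_eigen (v : 'rV_d) (a : algC) (q : {poly int}) : v *m A = a *: v ->
  v *m map_mx ratr (mul_mat (map_poly intr q).[y]) = (map_poly intr q).[a] *: v.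
  move=> vA; elim/poly_ind: q => [|q c IHq].
    by rewrite !rmorph0 !horner0 linear0 map_mx0 mulmx0 scale0r.
  rewrite !rmorphD !rmorphM /= !map_polyX !map_polyC /= !hornerMXaddC.
  rewrite linearD /= mul_matM map_mxD map_mxM mulmxDr mulmxA IHq -scalemxAl vA.
  rewrite scalerDl scalerA; congr (_ + _).
  rewrite -[c%:~R : K]mulr1 mulrzl -scaler_int linearZ /= mul_mat1 map_mxZ.
  by rewrite map_mx1 -scalemxAr mulmx1 rmorph_int.
have [r chA] := closed_field_poly_normal (char_poly A).
rewrite (monicP (char_poly_monic A)) scale1r in chA.
have /polyOverP/(_ d.-1) : char_poly A \is a polyOver Aint.
  rewrite chA big_seq rpred_prod // => a ra; rewrite polyOverXsubC.
  have /eigenvalueP[v vA v0] : eigenvalue A a.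
    by rewrite eigenvalue_root_char chA root_prod_XsubC.
  apply: (@root_monic_Aint (map_poly intr p)).
  - have := horner_eigen v a p vA; rewrite (rootP py0) linear0 map_mx0 mulmx0.
    by move=> /esym/eqP; rewrite scaler_eq0 (negPf v0) orbF.
  - exact: monic_map.
  - by apply/polyOverP => i; rewrite coef_map /= rpred_int.
by rewrite char_poly_trace ?rpredN // adim_gt0.
Qed.

(** Otherwise, expanding [x^-1] in the basis would give trace 0 to $x^{-1} x = 1$, whose trace is
    the degree. *)
Lemma trace_form_nondegenerate x : (forall i : 'I_d, \tr (mul_mat (b`_i * x)) = 0) -> x = 0.
Proof.
move=> tr0; apply/eqP; apply: contraT => x0.
have : \tr (mul_mat (x^-1 * x)) = 0.
  rewrite [x^-1]rVof_sum mulr_suml !linear_sum big1 // => i _.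
  by rewrite -scalerAl linearZ /= mxtraceZ tr0 mulr0.
rewrite mulVf // mul_mat1 mxtrace1 => /eqP.
by rewrite pnatr_eq0 -leqn0 leqNgt adim_gt0.
Qed.

End Basis.

Lemma exists_integral_multiple (K : fieldExtType rat) (x : K) :
  exists2 m : int, m != 0 & m%:~R *: x \in integral_elt K.
Proof.
pose b := vbasis {:K}; have bP : basis_of fullv b by apply: vbasisP.
(* This product of the denominators of all entries makes [m] times the matrix of [x] integral; the
   basis is an eigenvector for the eigenvalue $m x$. *)
pose m : int := \prod_i \prod_j denq (mul_mat b x i j).
have m0 : m != 0.
  by apply/prodf_neq0 => i _; apply/prodf_neq0 => j _; apply: denq_neq0.
exists m => //.
have intM i j : m%:~R * mul_mat b x i j \is a Num.int.
  rewrite /m (bigD1 i) //= (bigD1 j) //= -mulrA intrM mulrC mulrA -numqE.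
  by rewrite rpredM ?rpred_int.
have /choice[P PE] (ij : 'I_(\dim {:K}) * 'I_(\dim {:K})) :
    exists z : int, m%:~R * mul_mat b x ij.1 ij.2 = z%:~R.
  exact/intrP/intM.
apply: (@integral_int_eigen _ _ (fun i : 'I_(\dim {:K}) => b`_i) (\matrix_(i, j) P (i, j))).
  apply: contrapT => /forallNP b0; have /eqP := oner_neq0 K; apply.
  rewrite [1](rVof_sum bP) big1 // => i _.
  by have /negP/negPn/eqP-> := b0 i; rewrite scaler0.
move=> i; rewrite -scalerAl mulrC (mul_mat_sum bP) scaler_sumr.
apply: eq_bigr => j _; rewrite scalerA (PE (i, j)) mxE.
by rewrite scaler_int mulrzl.
Qed.

Section Discriminant.

Variables (K : fieldExtType rat) (b : (\dim {:K}).-tuple K).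
Local Notation d := (\dim {:K}).
Hypothesis b_basis : basis_of fullv b.
Hypothesis b_int : forall i : 'I_d, b`_i \in integral_elt K.

(** [D] is the discriminant, the determinant of the trace form $T$. The coordinates of [y] times $T$
    are the traces of the $y b_j$, which are integers, and the adjugate of $T$ inverts $T$ up to the
    factor [D]. *)
Lemma integral_bounded_denominator :
  exists2 D : int, D != 0 & forall y, y \in integral_elt K ->
    forall i, D%:~R * rVof b y 0 i \is a Num.int.
Proof.
have /choice[t tE] (ij : 'I_d * 'I_d) :
    exists z : int, \tr (mul_mat b (b`_(ij.1) * b`_(ij.2))) = z%:~R.
  by apply/intrP/(trace_integral b_basis); apply: rpredM; apply: b_int.
pose T := \matrix_(i, j) t (i, j).
have rVofT y j : (rVof b y *m map_mx intr T) 0 j = \tr (mul_mat b (y * b`_j)).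
  rewrite {2}[y](rVof_sum b_basis) mulr_suml !linear_sum mxE.
  apply: eq_bigr => i _; rewrite -scalerAl linearZ /= mxtraceZ !mxE.
  by rewrite (tE (i, j)).
exists (\det T).
  rewrite -(intr_eq0 rat) -det_map_mx; apply/det0P => -[v v0 vT].
  move/negP: v0; apply; rewrite -(vecof_eq0 b_basis); apply/eqP.
  apply: (trace_form_nondegenerate b_basis) => i.
  by rewrite mulrC -rVofT vecofK // vT mxE.
move=> y Zy i.
have -> : (\det T)%:~R * rVof b y 0 i =
    (rVof b y *m map_mx intr T *m map_mx intr (\adj T)) 0 i.
  by rewrite -mulmxA -map_mxM mul_mx_adj map_scalar_mx mul_mx_scalar [RHS]mxE.
rewrite mxE rpred_sum // => j _; rewrite rVofT mxE rpredM ?rpred_int //.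
by apply: (trace_integral b_basis); apply: rpredM => //; apply: b_int.
Qed.

End Discriminant.

Lemma spanning_basis (K : fieldExtType rat) (h : 'I_(\dim {:K}) -> K) :
    (forall x, exists c : 'I_(\dim {:K}) -> rat, x = \sum_i c i *: h i) ->
  basis_of fullv [tuple h i | i < \dim {:K}].
Proof.
move=> hP; rewrite basisEdim size_tuple leqnn andbT; apply/subvP => x _.
have [c ->] := hP x; apply: memv_suml => i _; apply: memvZ.
by apply: memv_span; apply/mapP; exists i; rewrite ?mem_enum.
Qed.

(** Once a rational basis is scaled to integral elements, the integers lie in the lattice spanned by
    the $D^{-1} b_i$, so they have as many generators as the degree. These span the field over the
    rationals and, by their number, form a basis. *)
Lemma integral_basis (K : fieldExtType rat) :
  exists2 b : (\dim {:K}).-tuple K, basis_of fullv b &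
    forall x, x \in integral_elt K <-> forall i, rVof b x 0 i \is a Num.int.
Proof.
have /choice[m /all_and2[m0 mZ]] (i : 'I_(\dim {:K})) :
    exists m : int, m != 0 /\ m%:~R *: (vbasis {:K})`_i \in integral_elt K.
  by have [m m0 mZ] := exists_integral_multiple (vbasis {:K})`_i; exists m.
have vbP := vbasisP {:K}.
pose b := [tuple (m i)%:~R *: (vbasis {:K})`_i | i < \dim {:K}].
have bE (i : 'I_(\dim {:K})) : b`_i = (m i)%:~R *: (vbasis {:K})`_i.
  by rewrite -tnth_nth tnth_mktuple.
have bP : basis_of fullv b.
  apply: spanning_basis => x; exists (fun i => rVof (vbasis {:K}) x 0 i / (m i)%:~R).
  rewrite {1}[x](rVof_sum vbP); apply: eq_bigr => i _.
  by rewrite scalerA divfK // intr_eq0.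
have [|D D0 denD] := integral_bounded_denominator bP.
  by move=> i; rewrite bE; apply: mZ.
have [||x Zx|h [hZ hP]] := @subgroup_generators K _
    (fun i : 'I_(\dim {:K}) => D%:~R^-1 *: b`_i) (fun x => x \in integral_elt K).
- exact: rpred0.
- by move=> x y; apply: rpredB.
- have /choice[c cE] i := intrP (denD x Zx i).
  exists c; rewrite [LHS](rVof_sum bP); apply: eq_bigr => i _.
  by rewrite -scaler_int scalerA -cE mulrC mulKf ?intr_eq0.
pose hb := [tuple h i | i < \dim {:K}].
have hbE (i : 'I_(\dim {:K})) : hb`_i = h i by rewrite -tnth_nth tnth_mktuple.
have hbP : basis_of fullv hb.
  apply: spanning_basis => x; have [k k0 /hP[c kx]] := exists_integral_multiple x.
  exists (fun i => k%:~R^-1 * (c i)%:~R).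
  rewrite -[LHS](scalerK (a := k%:~R)) ?intr_eq0 // kx scaler_sumr.
  by apply: eq_bigr => i _; rewrite -scalerA scaler_int.
exists hb => // x; split=> [/hP[c ->] i|xZ].
  have -> : \sum_i h i *~ c i = vecof hb (\row_i (c i)%:~R).
    by apply: eq_bigr => j _; rewrite mxE hbE scaler_int.
  by rewrite vecofK // mxE rpred_int.
rewrite [x](rVof_sum hbP) rpred_sum // => i _.
by have /intrP[c ->] := xZ i; rewrite hbE scaler_int rpredMz.
Qed.

(** * Heights and elements of minimal height *)

Lemma norm_det_le (R : numDomainType) n (A : 'M[R]_n) (B : R) :
  (forall i j, `|A i j| <= B) -> `|\det A| <= n`!%:R * B ^+ n.
Proof.
move=> AB; apply: le_trans (ler_norm_sum _ _ _) _.
apply: le_trans (_ : \sum_(s : 'S_n) B ^+ n <= _); last first.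
  by rewrite sumr_const card_Sn mulr_natl.
apply: ler_sum => s _; rewrite normrM normrX normrN1 expr1n mul1r normr_prod.
rewrite -[X in B ^+ X]card_ord -prodr_const.
by apply: ler_prod => i _; rewrite normr_ge0 AB.
Qed.

Lemma dist_lt_of_trunc_eq (R : archiRealFieldType) (N : nat) (x y : R) :
    (0 < N)%N -> 0 <= x -> 0 <= y ->
  Num.trunc (N%:R * x) = Num.trunc (N%:R * y) -> `|x - y| < N%:R^-1.
Proof.
move=> N0 x0 y0 txy; have N0' : 0 < N%:R :> R by rewrite ltr0n.
rewrite -(ltr_pM2l N0') divff ?gt_eqF // -{1}[N%:R]ger0_norm ?ltW // -normrM mulrBr.
have := truncn_itv (mulr_ge0 (ltW N0') x0); have := truncn_itv (mulr_ge0 (ltW N0') y0).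
rewrite -txy -natr1 => /andP[y1 y2] /andP[x1 x2]; rewrite ltr_norml; lra.
Qed.

Section Height.

Variables (K : fieldExtType rat) (b : (\dim {:K}).-tuple K).
Local Notation d := (\dim {:K}).
Hypothesis b_basis : basis_of fullv b.
Hypothesis b_integral : forall x,
  x \in integral_elt K <-> forall i, rVof b x 0 i \is a Num.int.
Local Notation crd := (rVof b).
Local Notation M := (mul_mat b).

Definition height (x : K) : rat := \sum_i `|crd x 0 i|.

Lemma height_ge0 x : 0 <= height x.
Proof. by apply: sumr_ge0. Qed.

Lemma coord_le_height x i : `|crd x 0 i| <= height x.
Proof. by rewrite /height (bigD1 i) //= lerDl sumr_ge0. Qed.

Lemma height_eq0 x : (height x == 0) = (x == 0).
Proof.
apply/eqP/eqP => [hx|->]; last first.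
  by rewrite /height big1 // => i _; rewrite linear0 mxE normr0.
apply/eqP; rewrite -(rVof_eq0 b_basis); apply/eqP/rowP=> i.
apply/eqP; rewrite [X in _ == X]mxE -normr_le0 -hx; exact: coord_le_height.
Qed.

Lemma height_gt0 x : (0 < height x) = (x != 0).
Proof. by rewrite lt_def height_ge0 andbT height_eq0. Qed.

Lemma basis_integral (i : 'I_d) : b`_i \in integral_elt K.
Proof. by apply/b_integral => j; rewrite rVofE // mxE rpred_nat. Qed.

Lemma mul_mat_integral x : x \in integral_elt K ->
  exists P : 'M[int]_d, M x = map_mx intr P.
Proof.
move=> Zx; have /choice[P PE] (ij : 'I_d * 'I_d) : exists z : int, M x ij.1 ij.2 = z%:~R.
  apply/intrP; have -> : M x ij.1 ij.2 = crd (b`_(ij.1) * x) 0 ij.2.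
    by rewrite rVofM // rVofE // -rowE [RHS]mxE.
  have /b_integral -> // : b`_(ij.1) * x \in integral_elt K.
  by apply: rpredM => //; apply: basis_integral.
exists (\matrix_(i, j) P (i, j)); apply/matrixP=> i j.
by rewrite [RHS]mxE [X in X%:~R]mxE -PE.
Qed.

Lemma det_mul_mat_neq0 x : x != 0 -> \det (M x) != 0.
Proof.
move=> x0; apply: contraTneq (oner_neq0 rat) => detx.
rewrite -(det1 _ d) -(mul_mat1 b_basis) -(mulfV x0) mul_matM //.
by rewrite det_mulmx detx mul0r eqxx.
Qed.

Lemma mul_mat_bound :
  exists2 C : rat, 0 < C & forall x i j, `|M x i j| <= C * height x.
Proof.
(* The sum runs over all structure constants of the basis; the 1 makes positivity immediate. *)
pose C := 1 + \sum_(p : 'I_d * 'I_d * 'I_d) `|M b`_(p.1.1) p.1.2 p.2|.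
exists C => [|x i j]; first by rewrite ltr_pwDl ?ltr01 // sumr_ge0.
rewrite {1}[x](rVof_sum b_basis) linear_sum summxE.
apply: le_trans (ler_norm_sum _ _ _) _; rewrite mulr_sumr; apply: ler_sum => k _.
rewrite linearZ /= mxE normrM mulrC ler_wpM2r //.
by rewrite /C (bigD1 (k, i, j)) //= addrCA lerDl addr_ge0 ?sumr_ge0.
Qed.

Lemma height_mul_bound :
  exists2 C : rat, 0 < C & forall x y, height (x * y) <= C * height x * height y.
Proof.
have [C C0 CP] := mul_mat_bound; exists (d%:R * C).
  by rewrite mulr_gt0 // ltr0n adim_gt0.
move=> x y; rewrite {1}/height.
apply: le_trans (_ : \sum_(i < d) C * height x * height y <= _); last first.
  by rewrite sumr_const card_ord -[X in X <= _]mulr_natl !mulrA.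
apply: ler_sum => j _; rewrite rVofM // mxE.
apply: le_trans (ler_norm_sum _ _ _) _.
rewrite mulrAC [X in _ <= X]mulrC mulr_suml; apply: ler_sum => i _.
by rewrite normrM ler_wpM2l.
Qed.

(* (sigma b_i)_i is an eigenvector of M z with eigenvalue sigma z, so the bound
   on the entries of M z does not depend on sigma. *)
Lemma embedding_bound : exists2 C : rat, 0 < C &
  forall (F : numFieldType) (sigma : {rmorphism K -> F}) z,
    `|sigma z| <= ratr (C * height z).
Proof.
have [C C0 CP] := mul_mat_bound; exists (d%:R * C).
  by rewrite mulr_gt0 // ltr0n adim_gt0.
move=> F sigma z; pose S := \sum_(i < d) `|sigma b`_i|.
have S0 : 0 < S.
  rewrite lt_def sumr_ge0 // andbT psumr_eq0 //; apply/negP => /allP b0.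
  have /eqP := oner_neq0 K; apply; rewrite [1](rVof_sum b_basis) big1 // => i _.
  have := b0 i (mem_index_enum _); rewrite normr_eq0 fmorph_eq0 => /eqP->.
  by rewrite scaler0.
rewrite -(ler_pM2r S0) {1}/S mulr_sumr.
apply: le_trans
  (_ : \sum_(i < d) \sum_(j < d) ratr (C * height z) * `|sigma b`_j| <= _); last first.
  by rewrite sumr_const card_ord -mulr_sumr -mulrnAl -rmorphMn /= -mulr_natl mulrA.
apply: ler_sum => i _; rewrite -normrM mulrC -rmorphM (mul_mat_sum b_basis) rmorph_sum.
apply: le_trans (ler_norm_sum _ _ _) _; apply: ler_sum => j _.
by rewrite rmorphZ_num normrM ler_wpM2r // -ratr_norm ler_rat.
Qed.

(** Integral ideals are predicates on the whole field, so that [z * x] can be tested for membership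
    with [z] a fraction. *)
Definition is_ideal (I : K -> Prop) := [/\ I 0, forall x y, I x -> I y -> I (x - y),
  forall a x, a \in integral_elt K -> I x -> I (a * x) &
  forall x, I x -> x \in integral_elt K].

Definition minimal_in (I : K -> Prop) x :=
  [/\ I x, x != 0 & forall y, I y -> y != 0 -> height x <= height y].

Lemma height_integral x : x \in integral_elt K -> exists n : nat, height x = n%:R.
Proof.
move=> /b_integral Zx; apply/natrP/rpred_sum => i _; exact: natr_norm_int.
Qed.

Lemma exists_minimal (I : K -> Prop) : is_ideal I -> (exists2 x, I x & x != 0) ->
  exists x, minimal_in I x.
Proof.
move=> [_ _ _ IO] [x0 Ix0 x00].
have ex : exists n : nat, `[< exists x, [/\ I x, x != 0 & height x = n%:R] >].
  by have [n hn] := height_integral (IO x0 Ix0); exists n; apply/asboolP; exists x0.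
case: (ex_minnP ex) => n /asboolP[x [Ix xn0 hx]] min_n; exists x; split=> // y Iy y0.
have [m hm] := height_integral (IO y Iy); rewrite hx hm ler_nat.
by apply/min_n/asboolP; exists y.
Qed.

End Height.

(** * Bounds on elements of minimal height *)

Section Geometry.

Variables (K : fieldExtType rat) (b : (\dim {:K}).-tuple K).
Local Notation d := (\dim {:K}).
Hypothesis b_basis : basis_of fullv b.
Hypothesis b_integral : forall x,
  x \in integral_elt K <-> forall i, rVof b x 0 i \is a Num.int.
Local Notation crd := (rVof b).
Local Notation M := (mul_mat b).
Local Notation height := (height b).
Local Notation minimal_in := (minimal_in b).

(** By Cramer's rule, the norm $\det(M x)$ times [x^-1] is read off the adjugate of [M x], whose
    entries are minors of order $d-1$. *)
Lemma height_inv_bound : exists2 C : rat, 0 < C & forall x, x != 0 ->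
  height x^-1 * `|\det (M x)| <= C * height x ^+ d.-1.
Proof.
have [C C0 CP] := mul_mat_bound b_basis.
exists (d%:R * (height 1 * (d.-1)`!%:R * C ^+ d.-1)).
  rewrite !mulr_gt0 ?exprn_gt0 ?ltr0n ?fact_gt0 ?adim_gt0 //.
  by rewrite height_gt0 ?oner_eq0.
move=> x x0.
have adjE : \det (M x) *: crd x^-1 = crd 1 *m \adj (M x).
  by rewrite -(mulVf x0) rVofM // -mulmxA mul_mx_adj mul_mx_scalar.
have adj_le i j : `|\adj (M x) i j| <= (d.-1)`!%:R * (C * height x) ^+ d.-1.
  rewrite mxE normrM normrX normrN1 expr1n mul1r.
  by apply: norm_det_le => k l; rewrite mxE [X in `|X|]mxE; apply: CP.
rewrite /height mulr_suml.
apply: le_trans (_ : \sum_(j < d)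
  height 1 * ((d.-1)`!%:R * (C * height x) ^+ d.-1) <= _); last first.
  by rewrite sumr_const card_ord -[X in X <= _]mulr_natl exprMn !mulrA.
apply: ler_sum => j _; rewrite mulrC -normrM.
have -> : \det (M x) * crd x^-1 0 j = (\det (M x) *: crd x^-1) 0 j by rewrite [RHS]mxE.
rewrite adjE mxE; apply: le_trans (ler_norm_sum _ _ _) _.
rewrite mulr_suml; apply: ler_sum => k _.
by rewrite normrM ler_wpM2l.
Qed.

(** Two elements with small nonnegative coordinates are congruent modulo $x O$. Their difference is
    a nonzero element of [I] of height at most $d T$, where $T^d$ is at most the absolute norm of
    [x]. *)
Lemma det_le_minimal_height (I : K -> Prop) x : is_ideal I -> minimal_in I x ->
  height x ^+ d <= d%:R ^+ d * `|\det (M x)|.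
Proof.
move=> [_ _ IM IO] [Ix x0 xmin].
have [P ME] := mul_mat_integral b_basis b_integral (IO _ Ix).
have detP0 : \det P != 0.
  by rewrite -(intr_eq0 rat) -det_map_mx -ME det_mul_mat_neq0.
have d0 : (0 < d)%N := adim_gt0 {:K}.
have exT : exists T, (T ^ d <= `|\det P|)%N by exists 0%N; rewrite exp0n.
have leT T : (T ^ d <= `|\det P|)%N -> (T <= `|\det P|)%N.
  by apply: leq_trans; case: T => // T; rewrite -{1}[T.+1]expn1 leq_pexp2l.
(* As [T] is maximal, the $(T+1)^d$ vectors with entries from 0 to [T] outnumber the classes modulo
   $x O$. *)
case: (ex_maxnP exT leT) => T TP maxT.
have [|c [e [w [ce cew]]]] := @congruent_mod_lattice d P {ffun 'I_d -> 'I_T.+1}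
    (fun c => \row_i (c i : nat)%:Z) detP0.
  rewrite card_ffun !card_ord ltnNge; apply/negP => /maxT.
  by rewrite ltnn.
pose y := vecof b (map_mx intr w) * x.
have yE i : crd y 0 i = (c i : nat)%:R - (e i : nat)%:R.
  rewrite rVofM // vecofK // ME -map_mxM -cew mxE.
  by rewrite !mxE rmorphB.
have y0 : y != 0.
  apply: contraNneq ce => y0; apply/eqP/ffunP=> i; apply/val_inj/eqP.
  by rewrite -(eqr_nat rat) -subr_eq0 -yE y0 linear0 mxE.
have hy : height y <= d%:R * T%:R.
  rewrite mulr_natl -[X in _ *+ X]card_ord -sumr_const; apply: ler_sum => i _.
  rewrite yE ler_norml; have := ltn_ord (c i); have := ltn_ord (e i).
  rewrite !ltnS -!(ler_nat rat); have := ler0n rat (c i); have := ler0n rat (e i).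
  lra.
have Iy : I y.
  apply: IM => //; apply/b_integral => i; rewrite vecofK // mxE rpred_int //.
have := le_trans (xmin y Iy y0) hy.
rewrite -(ler_pXn2r d0) ?nnegrE ?height_ge0 ?mulr_ge0 ?ler0n // => /le_trans.
apply.
rewrite exprMn ler_pM2l ?exprn_gt0 ?ltr0n // ME det_map_mx.
by rewrite -intr_norm -abszE -natrX ler_nat.
Qed.

(** The two preceding bounds are combined and a factor [height x ^+ d.-1] cancelled. With a bound
    uniform in [I], no conjugate of [x] is much smaller than its height. *)
Lemma minimal_height_inv_bound : exists2 C : rat, 0 < C &
  forall (I : K -> Prop) x, is_ideal I -> minimal_in I x ->
    height x^-1 * height x <= C.
Proof.
have [C C0 CP] := height_inv_bound; have d0 : (0 < d)%N := adim_gt0 {:K}.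
exists (d%:R ^+ d * C) => [|I x idI minx].
  by rewrite mulr_gt0 ?exprn_gt0 ?ltr0n.
have [_ x0 _] := minx; have hx0 : 0 < height x by rewrite height_gt0.
rewrite -(ler_pM2r (exprn_gt0 d.-1 hx0)) -mulrA -exprS prednK //.
apply: le_trans (_ : height x^-1 * (d%:R ^+ d * `|\det (M x)|) <= _).
  by rewrite ler_wpM2l ?height_ge0 // (det_le_minimal_height idI).
by rewrite mulrCA -mulrA ler_wpM2l ?exprn_ge0 // CP.
Qed.

(* Dirichlet: some multiple t y / x is so close to an integer a that t y - a x,
   an element of I, has smaller height than x and so vanishes. *)
Lemma minimal_common_multiple : exists2 m : nat, (0 < m)%N &
  forall (I : K -> Prop) x y, is_ideal I -> minimal_in I x -> I y ->
    exists2 a, a \in integral_elt K & m%:R * y = a * x.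
Proof.
have [C C0 CP] := height_mul_bound b_basis.
have d0 : (0 < d)%N := adim_gt0 {:K}.
have Cd0 : 0 <= C * d%:R by rewrite mulr_ge0 // ltW.
(* [N] exceeds $C d$, so a factor with all coordinates below $1/N$ in absolute value strictly lowers
   the height. *)
pose N := (Num.trunc (C * d%:R)).+1.
have CN : C * (d%:R / N%:R) < 1.
  rewrite mulrA ltr_pdivrMr ?ltr0n // mul1r.
  by have /andP[] := truncn_itv Cd0.
(* The multiplier [t] found below depends on [x] and [y], but is nonzero of absolute value at most
   $N^d$, so it divides this factorial. *)
exists (N ^ d)`!; first exact: fact_gt0.
move=> I x y [_ Isub IM IO] [Ix x0 xmin] Iy.
pose q (t : 'I_(N ^ d).+1) i := (t : nat)%:R * crd (y / x) 0 i.
pose frac (t : 'I_(N ^ d).+1) i := q t i - (Num.floor (q t i))%:~R.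
have frac_ge0 t i : 0 <= frac t i by rewrite subr_ge0 floor_le.
have frac_lt1 t i : frac t i < 1.
  by rewrite ltrBlDl -[1]mulr1z -intrD floorD1_gt.
have [|t1 [t2 [t12 /ffunP ft]]] := @pigeonhole 'I_(N ^ d).+1 {ffun 'I_d -> 'I_N}
    (fun t => [ffun i => inord (Num.trunc (N%:R * frac t i))]).
  by rewrite card_ffun !card_ord.
have close i : `|frac t1 i - frac t2 i| < N%:R^-1.
  apply: dist_lt_of_trunc_eq => //; have := congr1 val (ft i); rewrite !ffunE /= !inordK //.
    by rewrite truncn_lt_nat ?mulr_ge0 // gtr_pMr ?ltr0n.
  by rewrite truncn_lt_nat ?mulr_ge0 // gtr_pMr ?ltr0n.
pose t : int := (t1 : nat)%:Z - (t2 : nat)%:Z.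
pose a := vecof b (\row_i (Num.floor (q t1 i) - Num.floor (q t2 i))%:~R).
have Za : a \in integral_elt K.
  by apply/b_integral => i; rewrite vecofK // mxE rpred_int.
have tya : t%:~R * y = a * x.
  have <- : (t%:~R * (y / x) - a) * x + a * x = t%:~R * y.
    by rewrite -mulrDl subrK mulrA divfK.
  suff -> : (t%:~R * (y / x) - a) * x = 0 by rewrite add0r.
  apply/eqP; apply: contraT => r0.
  have /xmin/(_ r0) : I ((t%:~R * (y / x) - a) * x).
    rewrite mulrBl -mulrA divfK //; apply: Isub; apply: IM => //.
    by rewrite rpred_int.
  rewrite leNgt => /negP[]; apply: le_lt_trans (CP _ _) _.
  rewrite gtr_pMl ?height_gt0 //; apply: le_lt_trans CN; rewrite ler_pM2l //.
  rewrite mulr_natl -[X in _ *+ X]card_ord -sumr_const; apply: ler_sum => i _.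
  apply/ltW; apply: le_lt_trans (close i).
  have tE : t%:~R = (t1 : nat)%:R - (t2 : nat)%:R :> rat by rewrite rmorphB.
  rewrite -coord_rVof raddfB /= mulrzl -scaler_int linearZ /= coord_vecof // mxE tE.
  rewrite coord_rVof /frac /q rmorphB /= le_eqVlt; apply/orP; left; apply/eqP.
  congr `|_|; ring.
have t0 : t != 0 by rewrite subr_eq0 eqz_nat.
have /dvdzP[u uE] : (t %| (N ^ d)`!%:Z)%Z.
  rewrite dvdzE /= dvdn_fact // absz_gt0 t0 /=.
  by rewrite /t; have := ltn_ord t1; have := ltn_ord t2; lia.
exists (u%:~R * a); first by rewrite rpredM ?rpred_int.
by rewrite -mulrA -tya mulrA -intrM -uE.
Qed.

End Geometry.

(** * Products and powers of ideals *)

(** Finite sums of products. Since [A] and [S] are arbitrary sets, this also describes extended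
    ideals, with [A] the larger ring of integers and [S] the image of the ideal. *)
Inductive ideal_mul (K : fieldExtType rat) (A S : K -> Prop) : K -> Prop :=
| IdealMul0 : ideal_mul A S 0
| IdealMulD a s y of A a & S s & ideal_mul A S y : ideal_mul A S (a * s + y).

Fixpoint ideal_exp (K : fieldExtType rat) (A : K -> Prop) (k : nat) : K -> Prop :=
  if k is k'.+1 then ideal_mul A (ideal_exp A k') else fun x => x \in integral_elt K.

Section IdealArithmetic.

Variable K : fieldExtType rat.
Implicit Types (A I J S : K -> Prop).

Lemma ideal_mulD A S x y : ideal_mul A S x -> ideal_mul A S y -> ideal_mul A S (x + y).
Proof.
by elim=> [|a s z Aa Ss _ IH] Sy; [rewrite add0r | rewrite -addrA; apply: IdealMulD; auto].
Qed.

Lemma ideal_mul_mem A S a s : A a -> S s -> ideal_mul A S (a * s).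
Proof. by move=> Aa Ss; rewrite -[a * s]addr0; apply: IdealMulD; last apply: IdealMul0. Qed.

Lemma ideal_mul_is_ideal A S : is_ideal A -> is_ideal S -> is_ideal (ideal_mul A S).
Proof.
move=> [_ _ AM AO] [_ _ _ SO].
have mulM a x : a \in integral_elt K -> ideal_mul A S x -> ideal_mul A S (a * x).
  move=> Za; elim=> [|c s y Ac Ss _ IH]; first by rewrite mulr0; apply: IdealMul0.
  by rewrite mulrDr mulrA; apply: IdealMulD; rewrite //; apply: AM.
split=> //; first exact: IdealMul0.
- move=> x y Sx Sy; rewrite -[- y]mulN1r; apply: ideal_mulD => //.
  by apply: mulM => //; rewrite rpredN1.
- move=> x; elim=> [|a s y /AO Aa /SO Ss _ IH]; first exact: rpred0.
  by rewrite rpredD // rpredM.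
Qed.

Lemma unit_ideal : is_ideal (fun x : K => x \in integral_elt K).
Proof.
split=> //; first exact: rpred0.
- by move=> x y; apply: rpredB.
- by move=> a x; apply: rpredM.
Qed.

Lemma ideal_exp_is_ideal A k : is_ideal A -> is_ideal (ideal_exp A k).
Proof.
by move=> idA; elim: k => [|k IHk]; [apply: unit_ideal | apply: ideal_mul_is_ideal].
Qed.

Lemma ideal_mul_sub A S x : is_ideal A -> is_ideal S -> ideal_mul A S x -> S x.
Proof.
move=> [_ _ _ AO] [S0 Ssub SM _]; elim=> // a s y /AO Za Ss _ Sy.
by rewrite -[y]opprK; apply: (Ssub); [apply: SM | rewrite -sub0r; apply: (Ssub)].
Qed.

Lemma ideal_exp_sub A k l x : is_ideal A -> (k <= l)%N ->
  ideal_exp A l x -> ideal_exp A k x.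
Proof.
move=> idA /subnKC <-; elim: (l - k)%N => [|n IHn]; rewrite ?addn0 // addnS => Ax.
by apply: IHn; apply: ideal_mul_sub Ax => //; apply: ideal_exp_is_ideal.
Qed.

Lemma ideal_exp_mulX A k m a x : A a -> ideal_exp A k x -> ideal_exp A (m + k) (a ^+ m * x).
Proof.
move=> Aa Ax; elim: m => [|m IHm]; first by rewrite mul1r.
by rewrite addSn exprS -mulrA; apply: ideal_mul_mem.
Qed.

Lemma ideal_exp_neq0 A k : (exists2 a, A a & a != 0) -> exists2 x, ideal_exp A k x & x != 0.
Proof.
move=> [a Aa a0]; exists (a ^+ k * 1); last by rewrite mulr1 expf_neq0.
by rewrite -[k in ideal_exp _ k]addn0; apply: ideal_exp_mulX => //; apply: rpred1.
Qed.

(** [A] absorbs the integer coefficients, which gives the linear relations that [nakayama] takes as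
    input. *)
Lemma ideal_mul_span A S n (h : 'I_n -> K) y : is_ideal A ->
    (forall s, S s -> exists c : 'I_n -> int, s = \sum_i h i *~ c i) ->
  ideal_mul A S y -> exists2 e : 'I_n -> K, forall i, A (e i) & y = \sum_i e i * h i.
Proof.
move=> [A0 Asub AM _] Sh; elim=> [|a s {}y Aa /Sh[c ->] _ [e Ae ->]].
  by exists (fun=> 0) => //; rewrite big1 // => i _; rewrite mul0r.
exists (fun i => (c i)%:~R * a + e i) => [i|].
  rewrite -[e i]opprK; apply: (Asub); first by apply: AM; rewrite ?rpred_int.
  by rewrite -sub0r; apply: (Asub).
rewrite mulr_sumr -big_split; apply: eq_bigr => i _ /=.
by rewrite mulrDl -mulrzr; ring.
Qed.

Lemma ideal_generators I : is_ideal I ->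
  exists h : 'I_(\dim {:K}) -> K, (forall i, I (h i)) /\
    forall x, I x -> exists c : 'I_(\dim {:K}) -> int, x = \sum_i h i *~ c i.
Proof.
move=> [I0 Isub _ IO]; have [b b_basis b_int] := integral_basis K.
apply: (@subgroup_generators K _ (fun i : 'I_(\dim {:K}) => b`_i)) => // x /IO /b_int Zx.
have /choice[c cE] i := intrP (Zx i).
exists c; rewrite [LHS](rVof_sum b_basis); apply: eq_bigr => i _.
by rewrite cE scaler_int.
Qed.

Lemma ideal_generators_neq0 I n (h : 'I_n -> K) : (exists2 x, I x & x != 0) ->
  (forall x, I x -> exists c : 'I_n -> int, x = \sum_i h i *~ c i) -> exists i, h i != 0.
Proof.
move=> [x Ix x0] /(_ x Ix)[c xE]; apply: contrapT => /forallNP h0.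
move/eqP: x0; apply; rewrite xE big1 // => i _.
by have /negP/negPn/eqP-> := h0 i; rewrite mul0rz.
Qed.

(** Multiplication by [z] acts on finitely many generators of [I] by an integer matrix. *)
Lemma integral_of_stable_ideal I z : is_ideal I -> (exists2 x, I x & x != 0) ->
  (forall x, I x -> I (z * x)) -> z \in integral_elt K.
Proof.
move=> idI I_neq0 zI; have [h [Ih hP]] := ideal_generators idI.
have /choice[P PE] i := hP _ (zI _ (Ih i)).
apply: (@integral_int_eigen _ _ h (\matrix_(i, j) P i j)).
  exact: ideal_generators_neq0 I_neq0 hP.
by move=> i; rewrite PE; apply: eq_bigr => j _; rewrite mxE mulrzl.
Qed.

(** An inclusion of $A^k$ in $A \cdot A^k$ would put 1 in [A] by Nakayama's lemma. *)
Lemma ideal_exp_strict A k : is_ideal A -> (exists2 a, A a & a != 0) -> ~ A 1 ->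
  ~ forall x, ideal_exp A k x -> ideal_exp A k.+1 x.
Proof.
move=> idA A_neq0 A1 expS; apply: A1.
have idJ := ideal_exp_is_ideal k idA; have [h [Jh hP]] := ideal_generators idJ.
have [A0 Asub AM AO] := idA; apply: (@nakayama _ A _ h) => //.
- by move=> x y /AO Zx Ay; apply: AM.
- exact: ideal_generators_neq0 (ideal_exp_neq0 k A_neq0) hP.
- by move=> i; apply: ideal_mul_span idA hP (expS _ (Jh i)).
Qed.

End IdealArithmetic.

(** * Finiteness of ideal classes *)

Section IdealClasses.

Variables (K : fieldExtType rat) (b : (\dim {:K}).-tuple K).
Local Notation d := (\dim {:K}).
Hypothesis b_basis : basis_of fullv b.
Hypothesis b_integral : forall x,
  x \in integral_elt K <-> forall i, rVof b x 0 i \is a Num.int.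
Local Notation height := (height b).
Local Notation minimal_in := (minimal_in b).

(* With [m * I] inside [x * O], the fractional ideal [x^-1 * I] contains [O] and
   lies in [m^-1 * O]; it is thus determined by its residues in the finite set
   [m^-1 * O / O]. *)
Lemma finitely_many_classes :
  exists (T : finType) (cl : (K -> Prop) -> K -> T), forall I x J y,
    is_ideal I -> minimal_in I x -> is_ideal J -> minimal_in J y ->
    cl I x = cl J y -> forall z, I (z * x) -> J (z * y).
Proof.
have [[|m] // _ mP] := minimal_common_multiple b_basis b_integral.
have m0 : (m.+1)%:R != 0 :> K by rewrite -scaler_nat scaler_eq0 oner_eq0 pnatr_eq0.
pose vec (v : {ffun 'I_d -> 'I_m.+1}) : K := vecof b (\row_i (v i : nat)%:R) / m.+1%:R.
exists {ffun {ffun 'I_d -> 'I_m.+1} -> bool}.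
exists (fun I x => [ffun v => `[< I (vec v * x) >]]).
move=> I x J y idI minx idJ miny /ffunP clE z Izx.
have Zmz : m.+1%:R * z \in integral_elt K.
  have [_ x0 _] := minx; have [a Za] := mP I x (z * x) idI minx Izx.
  by rewrite mulrA => /(mulIf x0) ->.
have /choice[c cE] i := intrP ((b_integral _).1 Zmz i).
pose v := [ffun i => inord `|(c i %% m.+1)%Z|%N] : {ffun 'I_d -> 'I_m.+1}.
have Zzv : z - vec v \in integral_elt K.
  have -> : z - vec v = vecof b (\row_i (c i %/ m.+1)%Z%:~R).
    apply: (mulfI m0); rewrite mulrBr /vec [m.+1%:R * (_ / _)]mulrC divfK //.
    apply: (can_inj (rVofK b_basis)); apply/rowP=> i; rewrite -!coord_rVof raddfB /=.
    rewrite !coord_vecof // coord_rVof cE mulr_natl raddfMn /=.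
    rewrite coord_vecof // !mxE ffunE.
    rewrite inordK; last by rewrite -ltz_nat gez0_abs ?modz_ge0 ?ltz_mod.
    rewrite natr_absz ger0_norm ?modz_ge0 // -rmorphB /=.
    by rewrite {1}(divz_eq (c i) m.+1) addrK intrM mulr_natr.
  by apply/b_integral => i; rewrite vecofK // mxE rpred_int.
(* [z] and [vec v] differ by an integral element, and [L] contains all integral multiples of [w]. *)
have sub (L : K -> Prop) w : is_ideal L -> minimal_in L w -> L (z * w) <-> L (vec v * w).
  move=> [L0 Lsub LM _] [Lw _ _]; have Lzv := LM _ _ Zzv Lw; split=> Lz.
    by have := Lsub _ _ Lz Lzv; rewrite mulrBl opprB addrC subrK.
  have := Lsub _ _ Lz (Lsub _ _ L0 Lzv).
  by rewrite sub0r opprK mulrBl addrC subrK.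
have := clE v; rewrite !ffunE => IJ.
apply/(sub J) => //; apply/asboolP; rewrite -IJ; apply/asboolP.
exact/(sub I).
Qed.

Lemma finitely_many_of_bounded_height (B : nat) :
  exists (T : finType) (code : K -> T), forall x y,
    x \in integral_elt K -> y \in integral_elt K ->
    height x <= B%:R -> height y <= B%:R -> code x = code y -> x = y.
Proof.
exists {ffun 'I_d -> 'I_B.+1 * bool}.
(* Each coordinate is coded by absolute value and sign; the bound on the height keeps [inord] away
   from its default value. *)
exists (fun x => [ffun i => (inord `|Num.floor (coord b i x)|%N, coord b i x < 0)]).
move=> x y /b_integral Zx /b_integral Zy hx hy /ffunP xy.
apply: (can_inj (rVofK b_basis)); apply/rowP=> i.
have := xy i; rewrite !ffunE !coord_rVof => -[] /(congr1 val) /=.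
have coord_lt (z : K) : rVof b z 0 i \is a Num.int -> height z <= B%:R ->
    (absz (Num.floor (rVof b z 0%R i)) < B.+1)%N.
  move=> Zz hz; rewrite ltnS -(ler_nat rat) natr_absz intr_norm floorK //.
  exact: le_trans (coord_le_height b z i) hz.
rewrite !inordK ?coord_lt // => abs_eq sgn_eq.
rewrite (intrEsign (Zx i)) (intrEsign (Zy i)) sgn_eq; congr (_ * _).
by rewrite -(floorK (Zx i)) -(floorK (Zy i)) -!intr_norm -!abszE abs_eq.
Qed.

(** If all minimal heights were bounded, two powers $A^k$ and $A^l$ with $k < l$ would share both
    their class and their minimal element, so $A^k$ would lie in $A^l$ and hence in $A^{k+1}$. *)
Lemma unbounded_minimal_height (A : K -> Prop) (B : rat) :
    is_ideal A -> (exists2 a, A a & a != 0) -> ~ A 1 ->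
  exists k, forall x, ideal_exp A k x -> x != 0 -> B < height x.
Proof.
move=> idA A_neq0 A1; apply: contrapT => /forallNP small.
have /choice[x /all_and2[xmin xB]] k :
    exists x, minimal_in (ideal_exp A k) x /\ height x <= B.
  have [x minx] :=
    exists_minimal b_integral (ideal_exp_is_ideal k idA) (ideal_exp_neq0 k A_neq0).
  exists x; split=> //; rewrite leNgt; apply/negP => ltB; apply: (small k) => y Ay y0.
  by apply: lt_le_trans ltB _; case: minx => _ _; apply.
have {}xB k : height (x k) <= (Num.trunc B).+1%:R.
  by apply: le_trans (xB k) _; apply/ltW/truncnS_gt.
have [T [cl clP]] := finitely_many_classes.
have [T' [code codeP]] := finitely_many_of_bounded_height (Num.trunc B).+1.
have idE k := ideal_exp_is_ideal k idA.
have [|k [l [kl [cl_eq code_eq] _]]] := @nat_pigeonhole _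
  (fun k => (cl (ideal_exp A k) (x k), code (x k))) (fun _ _ => True).
  by exists 0%N.
have Zx n : x n \in integral_elt K by have [_ _ _] := idE n; apply; case: (xmin n).
have xE := codeP _ _ (Zx k) (Zx l) (xB k) (xB l) code_eq.
apply: (@ideal_exp_strict _ A k) => // y Ay; apply: ideal_exp_sub kl _ => //.
have x0 : x k != 0 by case: (xmin k).
rewrite -[y](divfK x0) {2}xE; apply: clP cl_eq _ _ => //.
by rewrite divfK.
Qed.

End IdealClasses.

Lemma principal_large_quotient (K : fieldExtType rat) (A : K -> Prop) :
    is_ideal A -> (exists2 a, A a & a != 0) -> ~ A 1 ->
  exists k m x, [/\ (0 < m)%N, x != 0, x \in integral_elt K,
    forall y, ideal_exp A (m + k) (x * y) <-> ideal_exp A k y &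
    forall (F : numFieldType) (sigma : {rmorphism K -> F}), 1 < `|sigma x|].
Proof.
move=> idA A_neq0 A1; have [b b_basis b_int] := integral_basis K.
have idE k := ideal_exp_is_ideal k idA; have Eneq0 k := ideal_exp_neq0 k A_neq0.
have /choice[x xmin] k := exists_minimal b_int (idE k) (Eneq0 k).
have [C1 C1_gt0 mulP] := height_mul_bound b_basis.
have [C2 C2_gt0 embP] := embedding_bound b_basis.
have [C3 C3_gt0 invP] := minimal_height_inv_bound b_basis b_int.
have [T [cl clP]] := finitely_many_classes b_basis b_int.
(* The threshold is the one that forces $|\sigma(x_k / x_l)| < 1$: [C2] bounds conjugates, [C1] the
   height of a product and [C3] the height of $x_l^{-1}$. For fixed [k] it is passed by all large
   [l], since the powers of [A] decrease. *)
have [|k [l [kl cl_eq large]]] := @nat_pigeonhole _ (fun k => cl (ideal_exp A k) (x k))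
    (fun k l => C2 * C1 * C3 * height b (x k) < height b (x l)).
  move=> k; have [l lP] := unbounded_minimal_height b_basis b_int
    (C2 * C1 * C3 * height b (x k)) idA A_neq0 A1.
  exists l => l' ll'; have [Ax x0 _] := xmin l'; apply: lP => //.
  exact: ideal_exp_sub ll' Ax.
have x0 n : x n != 0 by case: (xmin n).
have xlk0 : x l / x k != 0 by rewrite mulf_neq0 ?invr_neq0.
have mulE y : ideal_exp A l (x l / x k * y) <-> ideal_exp A k y.
  have -> : x l / x k * y = y / x k * x l by rewrite mulrC mulrA mulrAC.
  rewrite -{2}[y](divfK (x0 k)); split; first exact: clP (esym cl_eq) _.
  exact: clP cl_eq _.
exists k, (l - k)%N, (x l / x k); split; rewrite ?subn_gt0 //.
(* The quotient maps $A^k$ into $A^l$, which lies in $A^k$. *)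
- apply: (@integral_of_stable_ideal _ (ideal_exp A k)) => // y Ay.
  by apply: ideal_exp_sub (ltnW kl) _ => //; apply/mulE.
- by move=> y; rewrite subnK // ltnW.
move=> F sigma; have sx0 : sigma (x l / x k) != 0 by rewrite fmorph_eq0.
(* Heights bound conjugates only from above, so the inverse is estimated. *)
rewrite -invf_lt1 ?normr_gt0 // -normfV -fmorphV invf_div.
apply: le_lt_trans (embP F sigma _) _; have <- : ratr 1 = 1 :> F by rewrite rmorph1.
rewrite ltr_rat.
have hl0 : 0 < height b (x l) by rewrite height_gt0.
rewrite -(ltr_pM2r hl0) mul1r; apply: le_lt_trans large.
rewrite -!mulrA ler_pM2l // (mulrCA C1); apply: le_trans
  (_ : C1 * height b (x k) * height b (x l)^-1 * height b (x l) <= _).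
  by rewrite ler_pM2r // mulP.
by rewrite -mulrA mulrC ler_pM2r ?mulr_gt0 ?height_gt0 // (invP _ _ (idE l)).
Qed.

(** * Adjoining a root *)

(** [K'] is built inside [algC] from an [m]-th root of [iota x] and the images of a basis of [K].
    The map [j] is defined linearly on that basis; it is a ring morphism because [iota'] is
    injective and carries it to [iota]. *)
Lemma number_field_root (K : fieldExtType rat) (iota : {rmorphism K -> algC})
    (x : K) (m : nat) : (0 < m)%N ->
  exists (K' : fieldExtType rat) (j : {rmorphism K -> K'}) (iota' : {rmorphism K' -> algC})
         (beta : K'),
    (forall y, iota' (j y) = iota y) /\ beta ^+ m = j x.
Proof.
move=> m0; pose vb := vbasis {:K}.
have [K' [iota' [s Es _]]] := num_field_exists (m.-root (iota x) :: [seq iota e | e <- vb]).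
case: s Es => // beta t [betaE tE].
have tE' (i : 'I_(\dim {:K})) : iota' t`_i = iota vb`_i.
  have := congr1 (fun s => nth 0 s i) tE; have st := congr1 size tE.
  rewrite !size_map size_tuple in st.
  by rewrite (nth_map 0) ?st // (nth_map 0) ?size_tuple.
pose jf y := \sum_(i < \dim {:K}) coord vb i y *: t`_i.
have jfE y : iota' (jf y) = iota y.
  rewrite {2}(coord_vbasis (memvf y)) !rmorph_sum; apply: eq_bigr => i _.
  by rewrite !rmorphZ_num tE'.
have inj := fmorph_inj iota'.
have jA : zmod_morphism jf by move=> y z; apply: inj; rewrite rmorphB !jfE rmorphB.
have jM : monoid_morphism jf.
  by split=> [|y z]; apply: inj; rewrite ?rmorphM !jfE ?rmorph1 ?rmorphM.
pose mA := GRing.isZmodMorphism.Build _ _ jf jA.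
pose mM := GRing.isMonoidMorphism.Build _ _ jf jM.
pose j : {rmorphism K -> K'} := HB.pack jf mA mM.
exists K', j, iota', beta; split=> //.
by apply: inj; rewrite rmorphXn /= betaE rootCK // jfE.
Qed.

Lemma integral_of_exp (K : fieldExtType rat) (y : K) m : (0 < m)%N ->
  y ^+ m \in integral_elt K -> y \in integral_elt K.
Proof.
move=> m0 /integral_eltP Zym; apply/integral_eltP.
apply: (@integral_root_monic _ _ (intr : {rmorphism int -> K}) y ('X^m - (y ^+ m)%:P)).
- exact: monicXnsubC.
- by rewrite /root !hornerE subrr.
apply/integral_poly => i; rewrite coefB coefXn coefC; apply: integral_sub.
  exact: integral_nat.
by case: (i == 0)%N => //; apply: integral0.
Qed.

Lemma integral_rmorph_elt (K L : fieldExtType rat) (f : {rmorphism K -> L}) x :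
  x \in integral_elt K -> f x \in integral_elt L.
Proof. by move=> Zx; apply: (integral_elt_rmorph f (Integers Zx)). Qed.

(** * The root as a generator of the extended ideal *)

Section RootGeneratesExtension.

Variables (K K' : fieldExtType rat) (j : {rmorphism K -> K'}) (A : K -> Prop).
Variables (k m : nat) (x : K) (beta : K').
Hypotheses (idA : is_ideal A) (A_neq0 : exists2 a, A a & a != 0).
Hypotheses (m_gt0 : (0 < m)%N) (x_neq0 : x != 0) (betaX : beta ^+ m = j x).
Hypothesis AmE : forall y, ideal_exp A (m + k) (x * y) <-> ideal_exp A k y.

Lemma root_neq0 : beta != 0.
Proof.
apply: contra_neq x_neq0 => b0; apply/eqP.
by rewrite -(fmorph_eq0 j) -betaX b0 expr0n gtn_eqF.
Qed.
Let beta_neq0 := root_neq0.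

(** The [m]-th power is the image of $a^m / x$, which is integral because $a^m A^k$ lies in $A^{m+k}
    = x A^k$. *)
Lemma integral_div_root a : A a -> j a / beta \in integral_elt K'.
Proof.
move=> Aa; apply: (integral_of_exp m_gt0).
rewrite expr_div_n betaX -rmorphXn -fmorph_div /=.
apply/integral_rmorph_elt/(@integral_of_stable_ideal _ (ideal_exp A k)).
- exact: ideal_exp_is_ideal.
- exact: ideal_exp_neq0.
move=> y Ay; apply/AmE; rewrite mulrA mulrCA divff // mulr1.
exact: ideal_exp_mulX.
Qed.

Definition extended_ideal : K' -> Prop :=
  ideal_mul (fun c => c \in integral_elt K') (fun w => exists2 a, A a & w = j a).

Lemma extended_idealM c w : c \in integral_elt K' ->
  extended_ideal w -> extended_ideal (c * w).
Proof.
move=> Zc; elim=> [|e s y Ze Ss _ IH]; first by rewrite mulr0; apply: IdealMul0.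
by rewrite mulrDr mulrA; apply: IdealMulD => //; apply: rpredM.
Qed.

(* [B] is the integral ideal [beta^-1 * A O'], and [J O'] the extension of [A^k];
   dividing [A^m * A^k = x * A^k] by [beta^m = x] yields [J O' = B * J O']. *)
Lemma root_in_extended_ideal : extended_ideal beta.
Proof.
pose B c := c \in integral_elt K' /\ extended_ideal (beta * c).
have idJ := ideal_exp_is_ideal k idA; have [h [Jh hP]] := ideal_generators idJ.
(* For [P] the integers of [K'] this is $J O'$, and for [P] equal to [B] it is $B J O'$. *)
pose comb (P : K' -> Prop) w := exists2 c : 'I_(\dim {:K}) -> K',
  forall i, P (c i) & w = \sum_i c i * j (h i).
have comb0 (P : K' -> Prop) : P 0 -> comb P 0.
  by exists (fun=> 0) => //; rewrite big1 // => i _; rewrite mul0r.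
have combD (P : K' -> Prop) u w : (forall c e, P c -> P e -> P (c + e)) ->
    comb P u -> comb P w -> comb P (u + w).
  move=> PD [c Pc ->] [e Pe ->]; exists (fun i => c i + e i); first by move=> i; apply: PD.
  by rewrite -big_split; apply: eq_bigr => i _; rewrite mulrDl.
have combZ (P Q : K' -> Prop) a w : (forall c, P c -> Q (a * c)) ->
    comb P w -> comb Q (a * w).
  move=> PQ [c Pc ->]; exists (fun i => a * c i); first by move=> i; apply: PQ.
  by rewrite mulr_sumr; apply: eq_bigr => i _; rewrite mulrA.
pose Z c := c \in integral_elt K'.
have BZ c e : B c -> e \in integral_elt K' -> B (c * e).
  move=> [Zc Bc] Ze; split; first exact: rpredM.
  by rewrite mulrA mulrC; apply: extended_idealM.
have BD c e : B c -> B e -> B (c + e).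
  move=> [Zc Bc] [Ze Be]; split; first exact: rpredD.
  by rewrite mulrDr; apply: ideal_mulD.
have B0 : B 0 by split; [apply: rpred0 | rewrite mulr0; apply: IdealMul0].
have BA a : A a -> B (j a / beta).
  move=> Aa; split; first exact: integral_div_root.
  rewrite mulrC divfK // -[j a]mul1r; apply: ideal_mul_mem; first exact: rpred1.
  by exists a.
(* One more factor from [A] is paid for by one division by [beta]. With [P] the integers this serves
   repeatedly by induction; only the last of the [m] factors is used with [P] equal to [B]. *)
have step n (P : K' -> Prop) : P 0 -> (forall c e, P c -> P e -> P (c + e)) ->
    (forall a c, A a -> Z c -> P (j a / beta * c)) ->
    (forall y, ideal_exp A (n + k) y -> comb Z (j y / beta ^+ n)) ->
  forall y, ideal_exp A (n.+1 + k) y -> comb P (j y / beta ^+ n.+1).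
  move=> P0 PD PA IH y; elim=> [|a s z Aa Ss _ IHz].
    by rewrite rmorph0 mul0r; apply: comb0.
  rewrite rmorphD mulrDl; apply: combD => //; rewrite rmorphM exprS invfM mulrACA.
  by apply: combZ (IH s Ss) => c Zc; apply: PA.
have powZ n y : ideal_exp A (n + k) y -> comb Z (j y / beta ^+ n).
  elim: n y => [y /hP[c ->]|n IHn].
    rewrite expr0 divr1 rmorph_sum; exists (fun i => (c i)%:~R).
      by move=> i; apply: rpred_int.
    by apply: eq_bigr => i _; rewrite rmorphMz mulrzl.
  apply: step => //; first exact: rpred0.
    by move=> c e; apply: rpredD.
  by move=> a c Aa Zc; apply: rpredM => //; apply: integral_div_root.
have [_] : B 1; last by rewrite mulr1.
apply: (@nakayama _ B _ (fun i => j (h i))) => //.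
- move=> c e Bc Be; rewrite -[- e]mulrN1; apply: BD => //.
  by apply: BZ => //; rewrite rpredN1.
- by move=> c e Bc [Ze _]; apply: BZ.
- have [i hi0] := ideal_generators_neq0 (ideal_exp_neq0 k A_neq0) hP.
  by exists i; rewrite fmorph_eq0.
(* As $x h_i$ lies in $A^{m+k}$, dividing by $\beta^m = x$ writes $h_i$ as a combination with
   coefficients in [B]. *)
move=> i; have : ideal_exp A (m.-1.+1 + k) (x * h i) by rewrite prednK //; apply/AmE.
move/(step _ B) => /(_ B0 BD); rewrite prednK // betaX rmorphM mulrC mulKf ?fmorph_eq0 //.
apply=> [a c Aa Zc|]; last exact: powZ.
by apply: BZ => //; apply: BA.
Qed.

End RootGeneratesExtension.

(** * Transfer to ideals of the rings of integers *)

Theorem proposition2p4 (R : realType) (K : fieldExtType rat)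
  (iota : {rmorphism K -> algC}) (A : idealr (integers K))
  (A_neq0 : exists2 a : integers K, a \in A & a != 0) :
  exists (K' : fieldExtType rat) (j : {rmorphism K -> K'})
         (iota' : {rmorphism K' -> algC}),
    (forall x : K, iota' (j x) = iota x) /\
    strictly_large_ideal R (ideal_ext j A).
Proof.
pose AK x := exists2 a : integers K, a \in A & x = int_val a.
have idA : is_ideal AK.
  split=> [|x y [a Aa ->] [c Ac ->]|z x Zz [a Aa ->]|x [a _ ->]].
  - by exists 0; rewrite ?rpred0.
  - by exists (a - c); rewrite ?rpredB.
  - by exists (Integers Zz * a); rewrite ?idealMr.
  - exact: int_valP.
have AK_neq0 : exists2 a, AK a & a != 0.
  by have [a Aa a0] := A_neq0; exists (int_val a); first by exists a.
(* An [idealr] is proper by definition. *)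
have AK1 : ~ AK 1.
  move=> [a Aa a1]; have : a = 1 by apply: val_inj.
  by move=> aE; rewrite aE idealr1 in Aa.
have [k [m [x [m0 x0 Zx AmE large]]]] := principal_large_quotient idA AK_neq0 AK1.
have [K' [j [iota' [beta [iotaE betaX]]]]] := number_field_root iota x m0.
exists K', j, iota'; split=> //.
have Zbeta : beta \in integral_elt K'.
  by apply: (integral_of_exp m0); rewrite betaX; apply: integral_rmorph_elt.
have beta0 : beta != 0 := root_neq0 m0 x0 betaX.
exists (Integers Zbeta); split; last first.
  (* The [m]-th power of $\sigma(\beta)$ is the value at [x] of the embedding $\sigma \circ j$ of
     [K]. *)
  move=> sigma; rewrite -(expr_gt1 m0) // -normrX -rmorphXn /= betaX.
  exact: (large _ (sigma \o j)).
(* One inclusion holds because each generator $j(a)$ is [beta] times an integral element; for the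
   other, [beta] itself has to lie in the extended ideal. *)
apply/seteqP; split=> [_ [n [c [s [sA ->]]]]|_ [z _ <-]].
  have /choice[g gE] i : exists g : integers K', s i = Integers Zbeta * g.
    have [a Aa <-] := sA i.
    have Zg : j (int_val a) / beta \in integral_elt K'.
      apply: (integral_div_root idA AK_neq0 m0 x0 betaX AmE).
      by exists a.
    by exists (Integers Zg); apply: val_inj; rewrite /= mulrC divfK.
  exists (\sum_i c i * g i) => //; rewrite mulr_sumr.
  by apply: eq_bigr => i _; rewrite gE mulrCA.
(* Induction on the sum that expresses [beta] rewrites it as an indexed combination over the ring
   [integers K']. *)
have [e [n [c [s [sA eE]]]] eb] :
    exists2 e : integers K', ideal_ext j A e & int_val e = beta.
  elim: (root_in_extended_ideal idA AK_neq0 m0 x0 betaX AmE).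
    by exists 0 => //; exists 0%N, (fun=> 0), (fun=> 0); split; [case | rewrite big_ord0].
  move=> u _ y Zu [_ [a Aa ->] ->] _ [e [n [c [s [sA eE]]]] <-].
  exists (Integers Zu * int_map j a + e) => //.
  exists n.+1, (fun i => if unlift ord0 i is Some i' then c i' else Integers Zu).
  exists (fun i => if unlift ord0 i is Some i' then s i' else int_map j a); split.
    by move=> i; case: unliftP => // _; exists a.
  rewrite big_ord_recl unlift_none eE; congr (_ + _).
  by apply: eq_bigr => i _; rewrite liftK.
have -> : Integers Zbeta = e by apply: val_inj.
exists n, (fun i => z * c i), s; split=> //.
by rewrite eE mulrC mulr_sumr; apply: eq_bigr => i _; rewrite mulrA.
Qed.
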